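(* Let $\mathbf{A}$ be the matrix of a linear operator $A:\mathbb{R}^n\rightarrow\mathbb{R}^n$, and let its $j$th compound matrix $\mathbf{A}^{(j)}$ be $\mathcal{J}$-sign-symmetric primitive for every even $j$ with $1\leq j\leq n$. Then the algebraic multiplicity $m(\lambda)$ of any eigenvalue $\lambda$ of $A$ is not greater than $2$. Let $\lambda_1,\ldots,\lambda_n$ be the (complex) eigenvalues of $A$, repeated according to algebraic multiplicity and numbered in order of non-increasing modulus. Then $$\rho(A)=|\lambda_1|\geq|\lambda_2|>|\lambda_3|\geq|\lambda_4|>\ldots,$$ that is, $|\lambda_i|>|\lambda_{i+1}|$ for every even $i$ with $i+1\le n$. Moreover, for every pair $\lambda_i,\lambda_{i+1}$ with $i=1,3,5,\ldots$ and $i+1\le n$, one has $\arg(\lambda_{i+1})=-\arg(\lambda_i)$ (modulo $2\pi$). If $n$ is odd, then $\lambda_n$ is real.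
   Context: $\rho(A)$ denotes the spectral radius of $A$. The $j$th compound matrix $\mathbf{A}^{(j)}$ of an $n\times n$ real matrix $\mathbf{A}$ is the $C_n^j\times C_n^j$ matrix ($C_n^j=\frac{n!}{j!(n-j)!}$) of all minors of order $j$ of $\mathbf{A}$, with rows $i_1<\ldots<i_j$ and columns $k_1<\ldots<k_j$, numbered in lexicographic order. Let $\mathbf{B}=\{b_{ij}\}$ be a real $N\times N$ matrix. $\mathbf{B}$ is strictly $\mathcal{J}$-sign-symmetric if it contains no zero elements and there exists a subset $\mathcal{J}\subseteq\{1,\ldots,N\}$ such that $b_{ij}<0$ if and only if one of the numbers $i,j$ belongs to $\mathcal{J}$ and the other belongs to $\{1,\ldots,N\}\setminus\mathcal{J}$. $\mathbf{B}$ is $\mathcal{J}$-sign-symmetric if there exists a subset $\mathcal{J}\subseteq\{1,\ldots,N\}$ such that: (a) $b_{ij}\le 0$ whenever one of $i,j$ belongs to $\mathcal{J}$ and the other to $\{1,\ldots,N\}\setminus\mathcal{J}$; (b) $b_{ij}<0$ implies that one of $i,j$ belongs to $\mathcal{J}$ and the other to $\{1,\ldots,N\}\setminus\mathcal{J}$. $\mathbf{B}$ is $\mathcal{J}$-sign-symmetric primitive if $\mathbf{B}$ is $\mathcal{J}$-sign-symmetric and $\mathbf{B}^m$ is strictly $\mathcal{J}$-sign-symmetric for some natural number $m\ge 1$. The subset $\mathcal{J}$ is not fixed in advance: it is part of the existence statement for each matrix and may be different for different compound matrices. *)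

(* Defs.v *)
From mathcomp Require Import all_boot all_order all_algebra.
From mathcomp Require Import all_classical all_reals all_analysis.
From mathcomp Require Import complex.

Set Implicit Arguments.
Unset Strict Implicit.
Unset Printing Implicit Defensive.

Import Order.TTheory GRing.Theory Num.Theory.
Import ComplexField.Normc.

Local Open Scope ring_scope.
Local Open Scope classical_set_scope.
Local Open Scope complex_scope.

Section CompoundMatrix.
Variables n j : nat.

Definition lex_increasing_seq : seq (j.-tuple 'I_n) :=
  sort (fun s t : j.-tuplelexi 'I_n => (s <= t)%O)
    (enum [set t : j.-tuple 'I_n | sorted ltn (map val t)]%SET).

Fact size_lex_increasing : size lex_increasing_seq == 'C(n, j).
Proof. by rewrite size_sort -cardE card_ltn_sorted_tuples. Qed.

(* All i_1 < ... < i_j in {0, ..., n-1}, listed in lexicographic order. *)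
Definition lex_increasing : 'C(n, j).-tuple (j.-tuple 'I_n) :=
  Tuple size_lex_increasing.

Definition compound (R : comNzRingType) (A : 'M[R]_n) : 'M[R]_('C(n, j)) :=
  \matrix_(r, c)
    \det (mxsub (tnth (tnth lex_increasing r)) (tnth (tnth lex_increasing c)) A).

End CompoundMatrix.

Section SignSymmetry.
Variables (R : realType) (N : nat).
Implicit Type B : 'M[R]_N.

Definition separated (J : {set 'I_N}) (k l : 'I_N) : bool :=
  (k \in J) && (l \in (~: J)%SET) || (k \in (~: J)%SET) && (l \in J).

Definition strictly_J_sign_symmetric B : Prop :=
  (forall k l, B k l <> 0) /\
  exists J : {set 'I_N}, forall k l, B k l < 0 <-> separated J k l.

Definition J_sign_symmetric B : Prop :=
  exists J : {set 'I_N},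
    (forall k l, separated J k l -> B k l <= 0) /\
    (forall k l, B k l < 0 -> separated J k l).

Definition J_sign_symmetric_primitive B : Prop :=
  J_sign_symmetric B /\
  exists m : nat, (1 <= m)%N /\ strictly_J_sign_symmetric (B ^+ m).

End SignSymmetry.

Section Spectrum.
Variables (R : realType) (n : nat).
Implicit Type A : 'M[R]_n.

Definition complexify A : 'M[R[i]]_n := map_mx (real_complex R) A.

Definition alg_mult A (z : R[i]) : nat := mup z (char_poly (complexify A)).

Definition spectral_radius A : R :=
  sup [set normc z | z in [set z : R[i] | eigenvalue (complexify A) z]].

(* l lists the complex eigenvalues of A with their algebraic multiplicities,
   in order of non-increasing modulus. *)
Definition eigenvalue_enumeration A (l : 'I_n -> R[i]) : Prop :=
  char_poly (complexify A) = \prod_(k < n) ('X - (l k)%:P) /\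
  forall h k : 'I_n, (h <= k)%N -> normc (l k) <= normc (l h).

End Spectrum.

Section Argument.
Variable R : realType.
Implicit Type z : R[i].

(* Principal argument, in ]-pi, pi]; the value at 0 is meaningless. *)
Definition arg z : R :=
  let t := acos (complex.Re z / normc z) in
  if 0 <= complex.Im z then t else - t.

Definition eq_mod_2pi (s t : R) : Prop :=
  exists k : int, s = t + k%:~R * (pi *+ 2).

Lemma normc_gt0 z : z != 0 -> 0 < normc z.
Proof.
move=> z0; rewrite lt_neqAle eq_sym; apply/andP; split.
  by apply: contra_neq z0 => /eq0_normc.
by case: z {z0} => x y; rewrite sqrtr_ge0.
Qed.

Lemma argP z : z != 0 ->
  - pi < arg z <= pi /\
  z = (normc z * cos (arg z)) +i* (normc z * sin (arg z)).
Proof.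
move=> z0; have r0 := normc_gt0 z0.
have rE : normc z ^+ 2 = complex.Re z ^+ 2 + complex.Im z ^+ 2.
  by case: (z) => x y /=; rewrite sqr_sqrtr// addr_ge0 ?sqr_ge0.
have nr0 : normc z != 0 by rewrite gt_eqF.
set q := complex.Re z / normc z.
have q2 : 1 - q ^+ 2 = (complex.Im z / normc z) ^+ 2.
  apply: (mulIf (expf_neq0 2 nr0)).
  by rewrite mulrBl mul1r -!exprMn !divfK// rE addrAC subrr add0r.
have q1 : -1 <= q <= 1.
  rewrite -ler_norml -(@ler_pXn2r _ 2) ?nnegrE// expr1n real_normK ?num_real//.
  by rewrite -subr_ge0 q2 sqr_ge0.
have zE : z = complex.Re z +i* complex.Im z by case: (z).
have sE : sin (acos q) = `|complex.Im z| / normc z.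
  by rewrite sin_acos// q2 sqrtr_sqr normrM normfV (gtr0_norm r0).
rewrite /arg -/q; case: ifPn => [y0|]; [|rewrite -ltNge => y0].
  split; first by rewrite (lt_le_trans _ (acos_ge0 q1)) ?oppr_lt0 ?pi_gt0 ?acos_lepi.
  by rewrite acosK ?in_itv//= sE (ger0_norm y0) !(mulrC (normc z)) !divfK// -zE.
split.
  rewrite ltrN2 acos_ltpi ?(le_trans _ (pi_ge0 R)) ?oppr_le0 ?acos_ge0//.
  have /andP[q1l ->] := q1; rewrite andbT lt_neqAle q1l andbT.
  apply/eqP => qE; move: q2; rewrite -qE sqrrN expr1n subrr => /esym/eqP.
  by rewrite sqrf_eq0 mulf_eq0 invr_eq0 (negbTE nr0) orbF (lt_eqF y0).
rewrite cosN sinN acosK ?in_itv//= sE (ltr0_norm y0) mulNr opprK.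
by rewrite !(mulrC (normc z)) !divfK// -zE.
Qed.

End Argument.

(* Main.v *)
(* The eigenvalues of the j-th compound matrix are the products of j
   eigenvalues of A at distinct positions: over the complex numbers A is
   similar to a triangular matrix with any prescribed order of the eigenvalues
   on the diagonal, compounds are multiplicative by Cauchy-Binet, and the
   compound of a triangular matrix is triangular in the lexicographic order.
   A J-sign-symmetric primitive matrix is conjugate, by a diagonal matrix of
   signs, to a nonnegative primitive one, so by Perron-Frobenius it has a
   positive eigenvalue whose modulus strictly exceeds that of all the others,
   counted with multiplicity. For even j that eigenvalue of the compound must be
   lambda_1 ... lambda_j. Its positivity for j and j + 2 gives
   lambda_(j+1) lambda_(j+2) > 0, and comparing it with
   lambda_1 ... lambda_(j-1) lambda_(j+1) gives |lambda_j| > |lambda_(j+1)|. *)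
Require Import Defs.
From mathcomp Require Import all_boot all_order all_algebra all_fingroup.
From mathcomp Require Import all_classical all_reals all_analysis.
From mathcomp Require Import complex.

Set Implicit Arguments.
Unset Strict Implicit.
Unset Printing Implicit Defensive.

Import Order.TTheory GRing.Theory Num.Theory.
Import ComplexField.Normc.

Local Open Scope ring_scope.
Local Open Scope complex_scope.

(** * Triangular forms over a field and the spectra of powers *)

Section Triangularization.
Variable F : fieldType.

(** Over the polynomial ring the constant matrix [Q] commutes with ['X%:M], so it intertwines the
    characteristic matrices; its nonzero determinant then cancels. *)
Lemma char_poly_intertwined n (A B Q : 'M[F]_n) :
  Q \in unitmx -> Q *m A = B *m Q -> char_poly A = char_poly B.
Proof.
move=> Qu QA; pose Qp := map_mx polyC Q.
have detQ : \det Qp != 0.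
  by rewrite det_map_mx polyC_eq0 -unitfE -unitmxE.
apply: (mulfI detQ); rewrite [RHS]mulrC -!det_mulmx; congr (\det _).
by rewrite /char_poly_mx mulmxBr mulmxBl -!map_mxM QA scalar_mxC.
Qed.

Lemma intertwined_exp n (A B Q : 'M[F]_n) m :
  Q *m A = B *m Q -> Q *m (A ^+ m) = (B ^+ m) *m Q.
Proof.
move=> QA; elim: m => [|m IH]; first by rewrite !expr0 mulmx1 mul1mx.
by rewrite !exprS -![_ * _]/(_ *m _) mulmxA QA -mulmxA IH mulmxA.
Qed.

Lemma unitmx_with_first_row n (v : 'rV[F]_(1 + n)) :
  v != 0 -> exists2 Q : 'M[F]_(1 + n), Q \in unitmx & row_mx 1 0 *m Q = v.
Proof.
move=> v0; pose U : 'rV[F]_(1 + n) := row_mx 1 0.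
have Uf : U *m col_mx v 0 = v by rewrite mul_row_col mul1mx mul0mx addr0.
have [|Q Qu UQ] := @complete_unitmx F 1 (1 + n) U (col_mx v 0).
  rewrite Uf !rank_rV v0; case: eqP => // U0.
  by move: v0; rewrite -Uf U0 mul0mx eqxx.
by exists Q; rewrite // -UQ.
Qed.

(** One deflation step: when the new basis starts with a left eigenvector, the first row of the
    conjugate is [a] times the first unit row. Working with rows makes the result lower triangular,
    as [is_trig_mx] demands. *)
Lemma block_of_left_eigenvector n (A Q : 'M[F]_(1 + n)) (v : 'rV_(1 + n)) a :
    Q \in unitmx -> row_mx 1 0 *m Q = v -> v *m A = a *: v ->
  let B := Q *m A *m invmx Q in B = block_mx a%:M 0 (dlsubmx B) (drsubmx B).
Proof.
move=> Qu Qv vA B.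
have uB : row_mx 1 0 *m B = a *: row_mx 1 0 :> 'rV[F]_(1 + n).
  by rewrite !mulmxA Qv vA -scalemxAl -Qv mulmxK.
rewrite -[LHS]submxK.
suff [-> ->] : ulsubmx B = a%:M /\ ursubmx B = 0 by [].
have: row_mx 1 0 *m B = usubmx B.
  by rewrite -[in LHS](vsubmxK B) mul_row_col mul1mx mul0mx addr0.
rewrite uB /ulsubmx /ursubmx => <-.
by rewrite scale_row_mx row_mxKl row_mxKr scaler0 scale_scalar_mx mulr1.
Qed.

Lemma char_poly_lblock m n (A : 'M[F]_m) B (C : 'M[F]_n) :
  char_poly (block_mx A 0 B C) = char_poly A * char_poly C.
Proof.
rewrite /char_poly /char_poly_mx map_block_mx (scalar_mx_block m n).
by rewrite opp_block_mx add_block_mx raddf0 subr0 det_lblock.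
Qed.

Lemma char_poly_scalar1 (a : F) : char_poly (a%:M : 'M[F]_1) = 'X - a%:P.
Proof. by rewrite char_poly_trig ?mx11_is_trig // big_ord1 mxE. Qed.

(** Induction by deflation: a left eigenvector for [l ord0] splits off the first factor, and the
    lower right block has the remaining factors as characteristic polynomial. Always removing the
    head of the list puts the diagonal in the order of [l]. *)
Lemma triangularization n (A : 'M[F]_n) (l : 'I_n -> F) :
    char_poly A = \prod_(k < n) ('X - (l k)%:P) ->
  exists Q T : 'M[F]_n, [/\ Q \in unitmx, is_trig_mx T, Q *m A = T *m Q &
    forall k, T k k = l k].
Proof.
elim: n A l => [|n IH] A l Al.
  exists 1%:M, A; split; rewrite ?unitmx1 ?mul1mx ?mulmx1 //; last by case.
  by apply/is_trig_mxP; case.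
have /eigenvalueP[v vA v0] : eigenvalue A (l ord0).
  by rewrite eigenvalue_root_char Al big_ord_recl rootM root_XsubC eqxx.
have [Q Qu Qv] := unitmx_with_first_row v0.
have := block_of_left_eigenvector Qu Qv vA.
set B := _ *m invmx Q => /= BE.
have QA : Q *m A = B *m Q by rewrite mulmxKV.
clearbody B.
have charB : char_poly (drsubmx B) =
    \prod_(k < n) ('X - (l (lift ord0 k))%:P).
  have X0 : 'X - (l ord0)%:P != 0 by rewrite polyXsubC_eq0.
  apply: (mulfI X0); have := Al; rewrite big_ord_recl => <-.
  rewrite (char_poly_intertwined Qu QA) BE char_poly_lblock.
  by rewrite char_poly_scalar1 block_mxKdr.
have [P [T [Pu Tt PT Td]]] := IH _ _ charB.
have P1u : block_mx 1%:M 0 0 P \in @unitmx F (1 + n).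
  by rewrite unitmxE det_ublock det1 mul1r -unitmxE.
exists (block_mx 1%:M 0 0 P *m Q).
exists (block_mx (l ord0)%:M 0 (P *m dlsubmx B) T).
split.
- by rewrite unitmx_mul P1u Qu.
- rewrite (@is_trig_block_mx F 1 n 1 n) //.
  by rewrite eqxx mx11_is_trig Tt.
- rewrite -mulmxA QA !mulmxA; congr (_ *m _).
  have E : block_mx 1%:M 0 0 P *m
        block_mx (l ord0)%:M 0 (dlsubmx B) (drsubmx B) =
      block_mx (l ord0)%:M 0 (P *m dlsubmx B) T *m
        block_mx 1%:M 0 0 P :> 'M[F]_(1 + n).
    rewrite !mulmx_block !mulmx1 !mul1mx !mul0mx !mulmx0 !addr0 !add0r.
    by rewrite PT.
  by rewrite [in LHS]BE; exact: E.
- move=> k; case: (unliftP ord0 k) => [j|] ->.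
    have Ej : lift ord0 j = rshift 1 j by apply: val_inj.
    by rewrite [in LHS]Ej (@block_mxEdr F 1 n 1 n) Td.
  have : block_mx (l ord0)%:M 0 (P *m dlsubmx B) T
      (lshift n ord0) (lshift n ord0) = l ord0.
    by rewrite block_mxEul !mxE.
  by congr (_ = _); congr (fun_of_matrix _ _ _); apply: val_inj.
Qed.

Lemma mulmx_trig n (A B : 'M[F]_n) : is_trig_mx A -> is_trig_mx B ->
  is_trig_mx (A *m B) /\ forall k, (A *m B) k k = A k k * B k k.
Proof.
move=> /is_trig_mxP At /is_trig_mxP Bt; split=> [|k].
  apply/is_trig_mxP => i j ij; rewrite mxE big1 // => k _.
  have [ik|ki] := ltnP i k; first by rewrite At ?mul0r.
  by rewrite Bt ?mulr0 // (leq_ltn_trans ki).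
rewrite mxE (bigD1 k) //= big1 ?addr0 // => i; rewrite neq_ltn.
by case/orP => ik; [rewrite (Bt i k) ?mulr0 | rewrite (At k i) ?mul0r].
Qed.

Lemma triangularization_exp n (A : 'M[F]_n) (l : 'I_n -> F) m :
    char_poly A = \prod_(k < n) ('X - (l k)%:P) ->
  exists Q T : 'M[F]_n, [/\ Q \in unitmx, is_trig_mx T,
    Q *m (A ^+ m) = T *m Q & forall k, T k k = l k ^+ m].
Proof.
move=> /triangularization[Q [T [Qu Tt QA Td]]]; exists Q, (T ^+ m).
have [Tmt Tmd] : is_trig_mx (T ^+ m) /\ forall k, (T ^+ m) k k = l k ^+ m.
  elim: m => [|m [Tmt Tmd]].
    by split=> [|k]; rewrite expr0 ?scalar_mx_is_trig ?mxE ?eqxx.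
  rewrite exprS; have [-> d] := mulmx_trig Tt Tmt; split=> // k.
  by rewrite d Tmd Td exprS.
by split=> //; apply: intertwined_exp.
Qed.

Lemma char_poly_exp n (A : 'M[F]_n) (l : 'I_n -> F) m :
    char_poly A = \prod_(k < n) ('X - (l k)%:P) ->
  char_poly (A ^+ m) = \prod_(k < n) ('X - (l k ^+ m)%:P).
Proof.
move=> /(triangularization_exp m)[Q [T [Qu Tt QA Td]]].
rewrite (char_poly_intertwined Qu QA) char_poly_trig //.
by apply: eq_bigr => k _; rewrite Td.
Qed.

Lemma mxtrace_exp n (A : 'M[F]_n) (l : 'I_n -> F) m :
    char_poly A = \prod_(k < n) ('X - (l k)%:P) ->
  \tr (A ^+ m) = \sum_(k < n) l k ^+ m.
Proof.
move=> /(triangularization_exp m)[Q [T [Qu Tt QA Td]]].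
rewrite -(mulKmx Qu (A ^+ m)) mxtrace_mulC QA mulmxK //.
by apply: eq_bigr => k _; rewrite Td.
Qed.

(** Positions rather than values are singled out, so a repeated [r] still shows up among the roots
    of [p]. This is what lets dominance account for multiplicity. *)
Lemma prod_XsubC_cofactor_roots n (l : 'I_n -> F) r p :
    \prod_(k < n) ('X - (l k)%:P) = ('X - r%:P) * p ->
  exists k0, l k0 = r /\ forall k, k != k0 -> root p (l k).
Proof.
move=> lE; have [k0 lk0] : exists k0, l k0 = r.
  have /rootP : root (('X - r%:P) * p) r by rewrite rootM root_XsubC eqxx.
  rewrite -lE horner_prod => /eqP/prodf_eq0[k0 _].
  by rewrite hornerXsubC subr_eq0 => /eqP rk; exists k0.
exists k0; split=> // k kk0.
have Xr : 'X - r%:P != 0 by rewrite polyXsubC_eq0.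
have <- : \prod_(i < n | i != k0) ('X - (l i)%:P) = p.
  by apply: (mulfI Xr); rewrite -lE [RHS](bigD1 k0) //= lk0.
by rewrite (bigD1 k) //= rootM root_XsubC eqxx.
Qed.

End Triangularization.

(** * Increasing tuples and their lexicographic ranks *)

Section LexIncreasing.
Variables n j : nat.
Local Notation lex := (tnth (lex_increasing n j)).

Lemma mem_lex_increasing (t : j.-tuple 'I_n) :
  (t \in lex_increasing n j) = sorted ltn (map val t).
Proof. by rewrite mem_sort mem_enum inE. Qed.

Lemma sorted_lex_increasing r : sorted ltn (map val (lex r)).
Proof. by rewrite -mem_lex_increasing mem_tnth. Qed.

Lemma lex_increasing_inj : injective lex.
Proof. by apply/tuple_uniqP; rewrite sort_uniq enum_uniq. Qed.

Lemma lex_increasing_onto (t : j.-tuple 'I_n) :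
  sorted ltn (map val t) -> exists r, lex r = t.
Proof. by rewrite -mem_lex_increasing => /tnthP[r ->]; exists r. Qed.

Lemma ltn_tnth_increasing (t : j.-tuple 'I_n) :
  sorted ltn (map val t) -> {homo tnth t : i k / (i < k)%N}.
Proof.
move=> t_incr i k ik; have x0 := tnth t i.
rewrite !(tnth_nth x0) -!(nth_map _ 0%N val) ?size_tuple //.
by apply: (sorted_ltn_nth ltn_trans); rewrite // inE size_map size_tuple.
Qed.

Lemma leq_tnth_increasing (t : j.-tuple 'I_n) :
  sorted ltn (map val t) -> {homo tnth t : i k / (i <= k)%N}.
Proof.
move=> t_incr i k; rewrite leq_eqVlt => /predU1P[/val_inj -> //|].
by move/(ltn_tnth_increasing t_incr)/ltnW.
Qed.

Lemma leq_ord_tnth_increasing (t : j.-tuple 'I_n) (i : 'I_j) :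
  sorted ltn (map val t) -> (i <= tnth t i)%N.
Proof.
move=> t_incr; case: i => i; elim: i => // i IH ij /=.
apply: leq_ltn_trans (IH (ltnW ij)) _.
exact: ltn_tnth_increasing.
Qed.

(** The lexicographic order extends the componentwise one: if [c] came first, its tuple would be
    strictly smaller at the first place where the two differ. *)
Lemma leq_lex_increasing r c :
  (forall i, (tnth (lex r) i <= tnth (lex c) i)%N) -> (r <= c)%N.
Proof.
move=> le_rc; rewrite leqNgt; apply/negP => cr.
pose T : orderType _ := j.-tuplelexi 'I_n.
have lt_cr : (lex c < lex r :> T)%O.
  rewrite lt_neqAle; apply/andP; split.
    by apply: contraTneq cr => /lex_increasing_inj ->; rewrite ltnn.
  have t0 := lex r; rewrite !(tnth_nth t0).
  apply: (@sorted_leq_nth T <=%O) (ltnW cr); rewrite ?inE ?size_tuple //.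
  - exact: le_trans.
  - by apply: sort_sorted; apply: le_total.
case/ltxi_tuplePlt: lt_cr => k _.
by rewrite ltNge leEord le_rc.
Qed.

End LexIncreasing.

(** * Cauchy-Binet and compounds of triangular matrices *)

Section CompoundTheory.
Variables (K : comNzRingType) (n j : nat).
Local Notation lex := (tnth (lex_increasing n j)).
Implicit Types A B : 'M[K]_n.

(** Factoring an injection through its sorted image makes this a bijection onto the injective maps;
    it regroups the Cauchy-Binet sum. *)
Definition lex_arrangement (p : 'I_('C(n, j)) * 'S_j) : {ffun 'I_j -> 'I_n} :=
  [ffun i => tnth (lex p.1) (p.2 i)].

Lemma lex_increasing_tnth_inj r : injective (tnth (lex r)).
Proof.
apply/tuple_uniqP; rewrite -(map_inj_uniq val_inj).
by apply: (sorted_uniq ltn_trans ltnn); apply: sorted_lex_increasing.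
Qed.

Lemma lex_arrangement_inj : injective lex_arrangement.
Proof.
move=> [r s] [r' s'] /ffunP eq_rs.
have rr' : r = r'.
  apply: lex_increasing_inj; apply: val_inj; apply: (inj_map val_inj).
  apply: (irr_sorted_eq ltn_trans ltnn); try exact: sorted_lex_increasing.
  have sub a t b t' :
      (forall i, lex_arrangement (a, t) i = lex_arrangement (b, t') i) ->
      {subset map val (lex a) <= map val (lex b)}.
    move=> ab _ /mapP[_ /tnthP[i ->] ->]; apply: map_f.
    have := ab (t^-1%g i); rewrite !ffunE permKV => ->.
    exact: mem_tnth.
  by move=> x; apply/idP/idP; [apply: (sub _ s _ s') | apply: (sub _ s' _ s)].
rewrite -rr' in eq_rs *; congr pair; apply/permP => i.
by apply: (@lex_increasing_tnth_inj r); have := eq_rs i; rewrite !ffunE.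
Qed.

(** Surjectivity comes from counting: ['C(n, j)] times the factorial of [j] is the number of
    injections. *)
Lemma lex_arrangement_codom :
  (lex_arrangement @: [set: 'I_('C(n, j)) * 'S_j] =
    [set h : {ffun 'I_j -> 'I_n} | injectiveb h])%SET.
Proof.
apply/eqP; rewrite eqEcard; apply/andP; split.
  apply/fintype.subsetP => _ /imsetP[p _ ->]; rewrite inE; apply/injectiveP => i k.
  by rewrite !ffunE => /lex_increasing_tnth_inj/perm_inj.
rewrite (card_imset _ lex_arrangement_inj) cardsT card_prod card_Sn.
by rewrite card_inj_ffuns !card_ord bin_ffact.
Qed.

(** Expanding the product gives a sum over all maps [h] from ['I_j] to ['I_n]. A non-injective [h]
    repeats a row of [B] and contributes nothing; the injective ones are grouped by image, and the
    signs of the permutations rebuild the minor of [A]. *)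
Lemma Cauchy_Binet (A : 'M[K]_(j, n)) (B : 'M[K]_(n, j)) :
  \det (A *m B) =
  \sum_r \det (colsub (tnth (lex r)) A) * \det (rowsub (tnth (lex r)) B).
Proof.
transitivity (\sum_(h : {ffun 'I_j -> 'I_n})
    (\prod_i A i (h i)) * \det (rowsub h B)).
  pose AB s i k := A i k * B k ((s : 'S_j) i).
  transitivity (\sum_(h : {ffun 'I_j -> 'I_n}) \sum_(s : 'S_j)
      (-1) ^+ s * \prod_i AB s i (h i)).
    rewrite exchange_big; apply: eq_bigr => /= s _; rewrite -big_distrr /=.
    congr (_ * _); rewrite -(bigA_distr_bigA (AB s)) /=.
    by apply: eq_bigr => i _; rewrite mxE.
  apply: eq_bigr => h _; rewrite mulr_sumr; apply: eq_bigr => s _.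
  rewrite mulrCA; congr (_ * _); rewrite big_split; congr (_ * _).
  by apply: eq_bigr => i _; rewrite mxE.
rewrite (bigID (fun h : {ffun 'I_j -> 'I_n} => injectiveb h)) /= addrC.
rewrite big1 => [|h]; last first.
  case/injectivePn => i [k ik hik].
  by rewrite (determinant_alternate ik) ?mulr0 // => l; rewrite !mxE hik.
rewrite add0r -big_set /= -lex_arrangement_codom big_imset /=; last first.
  by move=> p q _ _; apply: lex_arrangement_inj.
under eq_bigl do rewrite inE.
rewrite -(pair_bigA _ (fun r s => \prod_i A i (lex_arrangement (r, s) i) *
  \det (rowsub (lex_arrangement (r, s)) B))) /=.
apply: eq_bigr => r _; rewrite mulr_suml; apply: eq_bigr => s _.
have -> : rowsub (lex_arrangement (r, s)) B =
    row_perm s (rowsub (tnth (lex r)) B).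
  by apply/matrixP => i k; rewrite !mxE ffunE.
rewrite row_permE det_mulmx det_perm mulrCA mulrA; congr (_ * _ * _).
by apply: eq_bigr => i _; rewrite mxE ffunE.
Qed.

Lemma compoundM A B : compound j (A *m B) = compound j A *m compound j B.
Proof.
apply/matrixP => r c; rewrite !mxE.
have -> : mxsub (tnth (lex r)) (tnth (lex c)) (A *m B) =
    rowsub (tnth (lex r)) A *m colsub (tnth (lex c)) B.
  by apply/matrixP => i k; rewrite !mxE; apply: eq_bigr => h _; rewrite !mxE.
rewrite Cauchy_Binet; apply: eq_bigr => q _; rewrite !mxE.
by congr (_ * _); congr (\det _); apply/matrixP => i k; rewrite !mxE.
Qed.

(** Pigeonhole: otherwise [s] would inject the [k.+1] indices up to [k] into the [k] indices below
    [k]. *)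
Lemma perm_crosses (s : 'S_j) (k : 'I_j) : exists i : 'I_j, (i <= k <= s i)%N.
Proof.
apply/existsP; apply: contraT => /existsPn no.
have lt_sk (i : 'I_j) : (i <= k)%N -> (s i < k)%N.
  by move=> ik; have := no i; rewrite ik -ltnNge.
pose f (i : 'I_k.+1) : 'I_k :=
  Ordinal (lt_sk (widen_ord (ltn_ord k) i) (ltn_ord i)).
have f_inj : injective f.
  by move=> i i' /(congr1 val) /= /val_inj/perm_inj/(congr1 val) /= /val_inj.
by have := leq_card f f_inj; rewrite !card_ord ltnn.
Qed.

(** Above the diagonal, every term of the Leibniz expansion of the minor contains an entry of [A]
    above its diagonal. *)
Lemma compound_trig A : is_trig_mx A -> is_trig_mx (compound j A).
Proof.
move=> /is_trig_mxP At; apply/is_trig_mxP => r c rc; rewrite mxE.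
apply: big1 => s _.
suff [i lt_i] : exists i, (tnth (lex r) i < tnth (lex c) (s i))%N.
  by rewrite (bigD1 i) //= mxE At // mul0r mulr0.
apply/existsP; apply: contraTT rc => /existsPn ge_cr; rewrite -leqNgt.
(* Writing [c_i] and [r_i] for the tuple entries, the chain is [c_k <= c_(s i) <= r_i <= r_k]. *)
apply: leq_lex_increasing => k; have [i /andP[ik ki]] := perm_crosses s k.
apply: leq_trans (leq_tnth_increasing (sorted_lex_increasing c) ki) _.
apply: leq_trans (leq_tnth_increasing (sorted_lex_increasing r) ik).
by rewrite leqNgt.
Qed.

Lemma compound_trig_diag A r : is_trig_mx A ->
  compound j A r r = \prod_(i < j) A (tnth (lex r) i) (tnth (lex r) i).
Proof.
move=> /is_trig_mxP At; rewrite mxE det_trig; last first.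
  apply/is_trig_mxP => i k ik; rewrite mxE At //.
  exact: ltn_tnth_increasing (sorted_lex_increasing r) _ _ ik.
by apply: eq_bigr => i _; rewrite mxE.
Qed.

End CompoundTheory.

(** * Eigenvalues of compounds *)

Section CompoundSpectrum.
Variables (F : fieldType) (n j : nat).
Local Notation lex := (tnth (lex_increasing n j)).

Lemma compound_unitmx (Q : 'M[F]_n) :
  Q \in unitmx -> compound j Q \in unitmx.
Proof.
move=> Qu; have [] // := @mulmx1_unit _ _ (compound j Q)
  (compound j (invmx Q) *m invmx (compound j 1%:M)).
(* Triangularity with ones on the diagonal suffices here; the compound of the identity need not be
   computed entrywise. *)
have det1 : compound j (1%:M : 'M[F]_n) \in unitmx.
  have trig1 := scalar_mx_is_trig n (1 : F).
  rewrite unitmxE det_trig ?compound_trig // big1 ?unitr1 // => r _.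
  by rewrite compound_trig_diag // big1 // => i _; rewrite mxE eqxx.
by rewrite mulmxA -compoundM mulmxV // mulmxV.
Qed.

Lemma char_poly_compound (A : 'M[F]_n) (l : 'I_n -> F) :
    char_poly A = \prod_(k < n) ('X - (l k)%:P) ->
  char_poly (compound j A) =
    \prod_(r < 'C(n, j)) ('X - (\prod_(i < j) l (tnth (lex r) i))%:P).
Proof.
move=> /triangularization[Q [T [Qu Tt QA Td]]].
have cQA : compound j Q *m compound j A = compound j T *m compound j Q.
  by rewrite -!compoundM QA.
rewrite (char_poly_intertwined (compound_unitmx Qu) cQA).
rewrite char_poly_trig ?compound_trig //; apply: eq_bigr => r _.
by rewrite compound_trig_diag //; under eq_bigr do rewrite Td.
Qed.

End CompoundSpectrum.

Lemma map_compound (K L : comNzRingType) (f : {rmorphism K -> L}) n j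
    (A : 'M[K]_n) :
  map_mx f (compound j A) = compound j (map_mx f A).
Proof.
apply/matrixP => r c; rewrite !mxE -det_map_mx; congr (\det _).
by apply/matrixP => i k; rewrite !mxE.
Qed.

(** * Geometric growth and positive lower bounds *)

Lemma ge0_eventually_dominated (F : archiRealFieldType) (a b c K : F) :
  0 <= a -> a < b -> 0 < c -> exists k : nat, K * a ^+ k < c * b ^+ k.
Proof.
rewrite le_eqVlt => /predU1P[<- b0 c0|a0 ab c0].
  by exists 1%N; rewrite !expr1 mulr0 mulr_gt0.
pose h := b / a - 1.
have h0 : 0 < h by rewrite subr_gt0 ltr_pdivlMr // mul1r.
(* Linear growth of [(b / a) ^+ k] is enough for the Archimedean property to conclude. *)
have bernoulli k : 1 + h *+ k <= (b / a) ^+ k.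
  elim: k => [|k IH]; first by rewrite mulr0n addr0 expr0.
  have ba : b / a = 1 + h by rewrite addrC subrK.
  rewrite exprSr {2}ba mulrDr mulr1 mulrSr addrA lerD //.
  rewrite ler_peMl ?(ltW h0) //; apply: le_trans IH.
  by rewrite lerDl mulrn_wge0 // ltW.
have := archi_boundP (normr_ge0 (K / (c * h))); set m := Num.bound _ => mP.
exists m; have am0 : 0 < a ^+ m by rewrite exprn_gt0.
rewrite -ltr_pdivlMr // -mulrA -expr_div_n mulrC -ltr_pdivrMr //.
apply: lt_le_trans (bernoulli m); rewrite ltr_pwDl ?ltr01 //.
have mP' := ltW (le_lt_trans (ler_norm _) mP).
rewrite -mulr_natl -ler_pdivrMr //; apply: le_trans mP'.
by rewrite invfM mulrA.
Qed.

(** The witness is the inverse of [1 + \sum_i (f i)^-1]. It avoids taking a minimum, so it works in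
    the partially ordered complex field, and the summand 1 covers an empty [I]. *)
Lemma exists_pos_lower_bound (F : numFieldType) (I : finType) (f : I -> F) :
  (forall i, 0 < f i) -> exists2 e, 0 < e & forall i, e <= f i.
Proof.
move=> f0; pose s := 1 + \sum_i (f i)^-1.
have s0 : 0 < s by rewrite ltr_wpDr // sumr_ge0 // => i _; rewrite invr_ge0 ltW.
exists s^-1 => [|i]; first by rewrite invr_gt0.
rewrite -[f i]invrK lef_pV2 ?posrE ?invr_gt0 //.
rewrite /s (bigD1 i) //= addrCA lerDl addr_ge0 // sumr_ge0 // => j _.
by rewrite invr_ge0 ltW.
Qed.

(** * Perron-Frobenius theory for positive and for primitive sign-symmetric matrices *)

Section PerronFrobenius.
Variable R : realType.
Local Notation C := R[i].

Lemma complex_normE (z : C) : `|z| = (normc z)%:C.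
Proof. by []. Qed.

Lemma exists_sorted_spectrum n (B : 'M[C]_n) : exists l : 'I_n -> C,
  char_poly B = \prod_(k < n) ('X - (l k)%:P) /\
  forall h k : 'I_n, (h <= k)%N -> normc (l k) <= normc (l h).
Proof.
have [r] := closed_field_poly_normal (char_poly B).
rewrite (monicP (char_poly_monic B)) scale1r => rE.
pose leN (x y : C) := normc y <= normc x.
pose s := sort leN r.
have sn : size s = n.
  have := size_char_poly B; rewrite rE size_prod_XsubC size_sort.
  by case.
have ss : sorted leN s by apply: sort_sorted => x y; apply: le_total.
exists (fun k => s`_k); split=> [|h k hk].
  have rs : perm_eq r s by rewrite perm_sym perm_sort.
  by rewrite rE (perm_big _ rs) /= (big_nth 0) sn big_mkord.
apply: (sorted_leq_nth _ _ 0 ss) => //.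
- by move=> y x z xy yz; apply: le_trans yz xy.
- by move=> x; rewrite /leN.
- by rewrite inE sn.
- by rewrite inE sn.
Qed.

Lemma ge0_eventually_dominatedC (a b c K : C) :
  0 <= a -> a < b -> 0 < c -> K \is Num.real ->
  exists k : nat, K * a ^+ k < c * b ^+ k.
Proof.
move=> a0 ab c0 /RRe_real KE.
have aE := RRe_real (ger0_real a0).
have bE := RRe_real (gtr0_real (le_lt_trans a0 ab)).
have cE := RRe_real (gtr0_real c0).
move: a0 ab c0; rewrite -aE -bE -cE -KE ler0c !ltcR => a0 ab c0.
have [k kP] := ge0_eventually_dominated (complex.Re K) a0 ab c0.
by exists k; rewrite -!rmorphXn -!rmorphM ltcR.
Qed.

Lemma posmx_row_gt0 n (M : 'M[C]_n) (v : 'rV[C]_n) :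
    (forall i j, 0 < M i j) -> (forall j, 0 <= v 0 j) -> v != 0 ->
  forall j, 0 < (v *m M) 0 j.
Proof.
move=> M0 v0 /rV0Pn[k vk] j; rewrite mxE (bigD1 k) //= ltr_pwDl //.
  by rewrite mulr_gt0 // lt_neqAle eq_sym vk v0.
by apply: sumr_ge0 => i _; rewrite mulr_ge0 // ltW.
Qed.

Lemma mx_exp_ge0 (F : numDomainType) n (M : 'M[F]_n) k :
  (forall i j, 0 <= M i j) -> forall i j, 0 <= (M ^+ k) i j.
Proof.
move=> M0; elim: k => [|k IH] i j; first by rewrite expr0 mxE ler0n.
by rewrite exprS mxE sumr_ge0 // => h _; rewrite mulr_ge0.
Qed.

(* If M were to stretch the positive row u by more than the largest modulus r
   of the eigenvalues, then so would M^k by q^k with q > r, whereas all entries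
   of M^k are bounded by a multiple of the trace of M^(k+1), so of r^(k+1). *)
Lemma no_superspectral_stretch n (M : 'M[C]_n.+1) (l : 'I_n.+1 -> C)
    (r : C) (u : 'rV_n.+1) :
    (forall i j, 0 < M i j) ->
    char_poly M = \prod_(k < n.+1) ('X - (l k)%:P) ->
    0 <= r -> (forall k, `|l k| <= r) -> (forall j, 0 < u 0 j) ->
  ~ (forall j, r * u 0 j < (u *m M) 0 j).
Proof.
move=> M0 Ml r0 lr u0 str.
have [d d0 dP] : exists2 d, 0 < d &
    forall j, d <= ((u *m M) 0 j - r * u 0 j) / u 0 j.
  by apply: exists_pos_lower_bound => j; rewrite divr_gt0 // subr_gt0.
pose q := r + d; have rq : r < q by rewrite ltrDl.
have uM j : q * u 0 j <= (u *m M) 0 j.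
  by rewrite mulrDl -lerBrDl -ler_pdivlMr.
have uMk k j : q ^+ k * u 0 j <= (u *m M ^+ k) 0 j.
  elim: k j => [|k IH] j; first by rewrite !expr0 mul1r mulmx1.
  rewrite exprS exprSr -[_ * M]/(_ *m M) mulmxA [leRHS]mxE.
  rewrite -mulrA mulrCA; apply: le_trans (ler_wpM2l _ (uM j)) _.
    by rewrite exprn_ge0 // (le_trans r0 (ltW rq)).
  rewrite mxE mulr_sumr ler_sum // => i _.
  by rewrite mulrA ler_wpM2r // ltW.
(* Since [e * u 0 i <= M j i], the sum over [j] of [e * (u *m M ^+ k) 0 j] is at most the trace of
   [M ^+ k.+1]. *)
have [e e0 eP] : exists2 e, 0 < e & forall p, e <= M p.2 p.1 / u 0 p.1.
  by apply: exists_pos_lower_bound => p; rewrite divr_gt0.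
pose U := \sum_j u 0 j.
have U0 : 0 < U.
  by rewrite /U big_ord_recl ltr_pwDl // sumr_ge0 // => i _; rewrite ltW.
have [k] := ge0_eventually_dominatedC r0 rq (mulr_gt0 e0 U0)
  (realM (realn _ n.+1) (ger0_real r0)).
rewrite le_gtF //.
have trE : \tr (M ^+ k.+1) <= n.+1%:R * r * r ^+ k.
  have tr0 : 0 <= \tr (M ^+ k.+1).
    by rewrite sumr_ge0 // => i _; apply: mx_exp_ge0 => ? ?; apply: ltW.
  rewrite -(ger0_norm tr0) (mxtrace_exp _ Ml).
  apply: le_trans (ler_norm_sum _ _ _) _.
  apply: (@le_trans _ _ (\sum_(i < n.+1) r ^+ k.+1)).
    by apply: ler_sum => i _; rewrite normrX lerXn2r ?nnegrE.
  by rewrite sumr_const card_ord exprS -mulrA mulr_natl.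
apply: le_trans trE; rewrite exprSr -mulrA [U * _]mulrC /U !mulr_sumr.
apply: (@le_trans _ _ (\sum_j e * (u *m M ^+ k) 0 j)).
  by apply: ler_sum => j _; rewrite ler_wpM2l // ltW.
rewrite /mxtrace -[_ * M]/(_ *m M) -/(mxtrace _) mxtrace_mulC.
apply: ler_sum => j _; rewrite !mxE mulr_sumr; apply: ler_sum => i _.
rewrite mulrA ler_wpM2r //; first by apply: mx_exp_ge0 => ? ?; apply: ltW.
by rewrite -ler_pdivlMr // (eP (i, j)).
Qed.

(** Let [v] collect the moduli of a left eigenvector for an eigenvalue of largest modulus [r]; the
    triangle inequality gives [r *: v <= v *m M] entrywise. If equality failed, applying the
    positive [M] to the nonzero defect would make it positive everywhere, so the row [v *m M] would
    be stretched by more than [r]. *)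
Lemma exists_left_perron_vector n (M : 'M[C]_n.+1) : (forall i j, 0 < M i j) ->
  exists r (v : 'rV[C]_n.+1), [/\ 0 < r, forall j, 0 < v 0 j & v *m M = r *: v].
Proof.
move=> M0; have [l [Ml lord]] := exists_sorted_spectrum M.
have /eigenvalueP[y yM y0] : eigenvalue M (l ord0).
  by rewrite eigenvalue_root_char Ml big_ord_recl rootM root_XsubC eqxx.
pose r := `|l ord0|; pose v := map_mx (fun z => `|z|) y.
have v_ge0 j : 0 <= v 0 j by rewrite mxE.
have v0 : v != 0.
  apply: contra_neq y0 => v0; apply/rowP => j; apply/eqP.
  rewrite mxE -normr_eq0.
  by have := congr1 (fun w : 'rV__ => w 0 j) v0; rewrite !mxE => ->.
have vM j : r * v 0 j <= (v *m M) 0 j.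
  have := congr1 (fun w : 'rV__ => w 0 j) yM; rewrite !mxE -normrM => <-.
  apply: le_trans (ler_norm_sum _ _ _) _; apply: ler_sum => i _.
  by rewrite normrM mxE (gtr0_norm (M0 _ _)).
have vM0 := posmx_row_gt0 M0 v_ge0 v0.
have [vMr|/eqP vMr] := eqVneq (v *m M) (r *: v).
  exists r, v; split=> // [|j].
    rewrite lt_neqAle normr_ge0 andbT eq_sym; apply/eqP => r0.
    by have := vM0 ord0; rewrite vMr r0 scale0r mxE ltxx.
  rewrite lt_neqAle v_ge0 andbT eq_sym; apply/eqP => vj0.
  by have := vM0 j; rewrite vMr mxE vj0 mulr0 ltxx.
have lr k : `|l k| <= r by rewrite /r !complex_normE lecR lord.
case: (no_superspectral_stretch M0 Ml (normr_ge0 _) lr vM0) => j.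
pose u := v *m M - r *: v.
have subE (a b : 'rV[C]_n.+1) i : (a - r *: b) 0 i = a 0 i - r * b 0 i.
  by rewrite !mxE.
have u_ge0 i : 0 <= u 0 i by rewrite subE subr_ge0.
have u0 : u != 0 by rewrite subr_eq0; apply/eqP.
rewrite -subr_gt0 -subE; have := posmx_row_gt0 M0 u_ge0 u0 j.
by rewrite /u mulmxBl -scalemxAl.
Qed.

(* The weighted sum of the v_i |y_i| is multiplied by at most s under M. *)
Lemma eigenvalue_le_weighted_col_sum n (M : 'M[C]_n.+1) (v : 'rV[C]_n.+1) s z :
    (forall i j, 0 <= M i j) -> (forall j, 0 < v 0 j) -> v *m M = s *: v ->
  root (char_poly M) z -> `|z| <= s.
Proof.
move=> M0 v0 vM; have -> : char_poly M = char_poly M^T.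
  rewrite /char_poly -det_tr; congr (\det _).
  by rewrite /char_poly_mx raddfB /= tr_scalar_mx map_trmx.
rewrite -eigenvalue_root_char => /eigenvalueP[y yM y0].
pose W := \sum_i v 0 i * `|y 0 i|.
have W0 : 0 < W.
  have [k yk] := rV0Pn _ y0.
  rewrite /W (bigD1 k) //= ltr_pwDl ?mulr_gt0 ?normr_gt0 //.
  by apply: sumr_ge0 => i _; rewrite mulr_ge0 ?normr_ge0 // ltW.
rewrite -(ler_pM2r W0) /W !mulr_sumr.
apply: (@le_trans _ _ (\sum_i v 0 i * \sum_j M i j * `|y 0 j|)).
  apply: ler_sum => i _; rewrite mulrCA ler_wpM2l ?(ltW (v0 _)) // -normrM.
  have := congr1 (fun w : 'rV__ => w 0 i) yM; rewrite !mxE => <-.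
  apply: le_trans (ler_norm_sum _ _ _) _; apply: ler_sum => j _.
  by rewrite mxE normrM mulrC ger0_norm.
under eq_bigr do rewrite mulr_sumr.
rewrite exchange_big /=; apply: ler_sum => j _.
have := congr1 (fun w : 'rV__ => w 0 j) vM; rewrite !mxE mulrA => <-.
by rewrite mulr_suml; apply: ler_sum => i _; rewrite mulrA.
Qed.

(* Subtracting from M a column times its left Perron vector v lowers the
   eigenvalue r of v and keeps all the others, which are then at most the
   lowered eigenvalue because the difference is still nonnegative. *)
Lemma perron_dominant n (M : 'M[C]_n) (l : 'I_n -> C) :
    (0 < n)%N -> (forall i j, 0 < M i j) ->
    char_poly M = \prod_(k < n) ('X - (l k)%:P) ->
  exists k0, 0 < l k0 /\ forall k, k != k0 -> `|l k| < `|l k0|.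
Proof.
case: n M l => // n M l _ M0 Ml.
have [r [v [r0 v0 vM]]] := exists_left_perron_vector M0.
(* This choice of [e] gives [e * v 0 j <= M i j], which keeps [M'] nonnegative. *)
have [e e0 eP] : exists2 e, 0 < e & forall p, e <= M p.1 p.2 / v 0 p.2.
  by apply: exists_pos_lower_bound => p; rewrite divr_gt0.
pose w : 'cV[C]_n.+1 := const_mx e.
pose M' := M - w *m v; pose s := r - \sum_j v 0 j * e.
have M'0 i j : 0 <= M' i j.
  by rewrite !mxE big_ord1 !mxE subr_ge0 -ler_pdivlMr // (eP (i, j)).
have vM' : v *m M' = s *: v.
  rewrite mulmxBr vM mulmxA [v *m w]mx11_scalar mul_scalar_mx scalerBl.
  by congr (_ - _ *: _); rewrite mxE; apply: eq_bigr => j _; rewrite !mxE.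
have sr : s < r.
  rewrite ltrBlDr ltrDl big_ord_recl ltr_pwDl ?mulr_gt0 //.
  by rewrite sumr_ge0 // => j _; rewrite mulr_ge0 // ltW.
have vn0 : v != 0.
  by apply/eqP => v00; have := v0 ord0; rewrite v00 mxE ltxx.
have [Q Qu Qv] := unitmx_with_first_row (vn0 : (v : 'rV_(1 + n)) != 0).
have := block_of_left_eigenvector Qu Qv vM.
have := block_of_left_eigenvector Qu Qv vM'.
set B' := _ *m invmx Q; set B := _ *m invmx Q => /= B'E BE.
(* In the new basis [v] is the first unit row, so the conjugate of [w *m v] lives in the first
   column and leaves the lower right block alone. *)
have drE : drsubmx B' = drsubmx B.
  rewrite /B' /M' mulmxBr mulmxBl /drsubmx !raddfB /=.
  rewrite -Qv !mulmxA mulmxK // -[Q *m w *m _]/(Q *m w *m row_mx 1 0).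
  rewrite mul_mx_row mulmx0 [X in _ - X](_ : _ = 0) ?subr0 //.
  by apply/matrixP => i j; rewrite 2!mxE row_mxEr !mxE.
have charM : char_poly M = ('X - r%:P) * char_poly (drsubmx B).
  have QM : Q *m M = B *m Q by rewrite mulmxKV.
  rewrite (char_poly_intertwined Qu QM) [in LHS]BE char_poly_lblock.
  by rewrite char_poly_scalar1.
have charM' : char_poly M' = ('X - s%:P) * char_poly (drsubmx B).
  have QM : Q *m M' = B' *m Q by rewrite mulmxKV.
  rewrite (char_poly_intertwined Qu QM) [in LHS]B'E char_poly_lblock.
  by rewrite char_poly_scalar1 drE.
have [k0 [lk0 lroot]] := prod_XsubC_cofactor_roots (etrans (esym Ml) charM).
exists k0; rewrite lk0; split=> [|k /lroot kroot]; first exact: r0.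
rewrite (gtr0_norm r0); apply: le_lt_trans sr.
apply: (eigenvalue_le_weighted_col_sum M'0 v0 vM').
by rewrite charM' rootM kroot orbT.
Qed.

Lemma complexifyX n (B : 'M[R]_n) m : complexify (B ^+ m) = complexify B ^+ m.
Proof.
elim: m => [|m IH]; first by rewrite !expr0 /complexify map_mx1.
by rewrite !exprS -IH; apply: map_mxM.
Qed.

(* The sign matrix of J conjugates a J-sign-symmetric matrix to a nonnegative
   one; passing to both m and m + 1 gives the sign of the dominant eigenvalue,
   which is not determined by that of its m-th power. *)
Lemma primitive_signature n (B : 'M[R]_n) : J_sign_symmetric_primitive B ->
  exists m (D : 'M[R]_n), [/\ D \in unitmx,
    forall i j, 0 < (D *m B ^+ m *m invmx D) i j &
    forall i j, 0 < (D *m B ^+ m.+1 *m invmx D) i j].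
Proof.
case=> -[J [Jle Jlt]] [m [m_gt0 [Bm0 _]]].
pose s := \row_i (if i \in J then -1 else 1) : 'rV[R]_n; pose D := diag_mx s.
have DD : D *m D = 1%:M.
  rewrite mulmx_diag; apply/matrixP => i j; rewrite !mxE.
  by case: (i \in J); rewrite ?mulrNN mulr1.
have Du : D \in unitmx by case: (mulmx1_unit DD).
have DV : invmx D = D by rewrite -[RHS](mulKmx Du) DD mulmx1.
have DE (A : 'M[R]_n) i j : (D *m A *m invmx D) i j = s 0 i * A i j * s 0 j.
  by rewrite DV mul_mx_diag mul_diag_mx !mxE.
have s_neq0 i : s 0 i != 0.
  by rewrite mxE; case: ifP => _; rewrite ?oppr_eq0 oner_eq0.
pose P := D *m B *m invmx D.
have P0 i j : 0 <= P i j.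
  rewrite /P DE !mxE; have := Jle i j; have := Jlt i j; rewrite /Defs.separated !inE.
  case: (i \in J); case: (j \in J) => /= lt le;
    rewrite ?mulN1r ?mul1r ?mulrN1 ?mulr1 ?opprK ?oppr_ge0 ?le //;
    by rewrite leNgt; apply/negP => /lt.
have PX k : P ^+ k = D *m B ^+ k *m invmx D.
  elim: k => [|k IH]; first by rewrite !expr0 mulmx1 mulmxV.
  by rewrite !exprSr IH -[_ * P]/(_ *m P) /P !mulmxA mulmxKV // -(mulmxA D).
have Pm i j : 0 < (P ^+ m) i j.
  rewrite lt_neqAle mx_exp_ge0 // andbT eq_sym PX DE.
  by rewrite !mulf_neq0 ?s_neq0 //; apply/eqP; apply: Bm0.
exists m, D; split=> // i j; first by rewrite -PX.
rewrite -PX exprSr mxE.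
(* A zero column of [P] would persist in [P ^+ m], as [m] is positive. *)
have [k Pkj] : exists k, P k j != 0.
  apply/existsP; apply: contraT => /existsPn Pj0.
  have := Pm i j; rewrite -(prednK m_gt0) exprSr mxE big1 ?ltxx // => k _.
  by have := Pj0 k; rewrite negbK => /eqP ->; rewrite mulr0.
rewrite (bigD1 k) //= ltr_pwDl //.
  by apply: mulr_gt0; rewrite // lt_neqAle eq_sym Pkj P0.
by rewrite sumr_ge0 // => h _; rewrite mulr_ge0 // ltW.
Qed.

(** Positivity of the conjugates of two consecutive powers yields two positions of strictly largest
    modulus, which must coincide. There both [l k0 ^+ m] and [l k0 ^+ m.+1] are positive, hence so
    is [l k0]. *)
Lemma primitive_dominant n (B : 'M[R]_n) (l : 'I_n -> C) :
    (0 < n)%N -> J_sign_symmetric_primitive B ->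
    char_poly (complexify B) = \prod_(k < n) ('X - (l k)%:P) ->
  exists k0, 0 < l k0 /\ forall k, k != k0 -> `|l k| < `|l k0|.
Proof.
move=> n0 /primitive_signature[m [D [Du Dm Dm1]]] Bl.
have dom k : (forall i j, 0 < (D *m B ^+ k *m invmx D) i j) ->
    exists k0, 0 < l k0 ^+ k /\ forall h, h != k0 -> `|l h| < `|l k0|.
  move=> Dk; pose M := complexify (D *m B ^+ k *m invmx D).
  have M0 i j : 0 < M i j by rewrite mxE ltcR.
  have cDu : complexify D \in unitmx by rewrite map_unitmx.
  have DM : complexify D *m complexify (B ^+ k) = M *m complexify D.
    by rewrite /M /complexify -!map_mxM mulmxKV.
  have := char_poly_exp k Bl.
  rewrite -complexifyX (char_poly_intertwined cDu DM).
  case/(perron_dominant n0 M0) => k0 [lk0 dom]; exists k0; split=> // h /dom.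
  rewrite !normrX; apply: contraTT => nlt.
  rewrite -real_leNgt ?realX ?normr_real // lerXn2r ?nnegrE ?normr_ge0 //.
  by rewrite real_leNgt ?normr_real.
have [k0 [lk0 dom0]] := dom _ Dm; have [k1 [lk1 dom1]] := dom _ Dm1.
exists k0; split=> //.
have k01 : k1 = k0.
  apply/eqP; apply: contraT => k10; have := dom0 _ k10.
  by rewrite lt_gtF // dom1 // eq_sym.
by move: lk1; rewrite k01 exprSr pmulr_rgt0.
Qed.

End PerronFrobenius.

(** * Increasing tuples from functions, and root multiplicities as counts of positions *)

Lemma sorted_mktuple n j (f : 'I_j -> 'I_n) :
  {homo f : i k / (i < k)%N} -> sorted ltn (map val (mktuple f)).
Proof.
move=> f_incr; rewrite /= -map_comp sorted_map.
apply: (@sub_sorted _ (relpre val ltn)); first by move=> i k; apply: f_incr.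
by rewrite -sorted_map val_enum_ord iota_ltn_sorted.
Qed.

Lemma mup_prod_XsubC (F : fieldType) n (l : 'I_n -> F) z :
  mup z (\prod_(k < n) ('X - (l k)%:P)) = #|[set k | l k == z]|.
Proof.
transitivity (\sum_(k < n) (l k == z))%N; last first.
  rewrite -sum1_card [RHS]big_mkcond; apply: eq_bigr => k _.
  by rewrite inE; case: eqP.
(* Nonvanishing is carried along because additivity of [mup] over products requires it. *)
have [] // : \prod_(k < n) ('X - (l k)%:P) != 0 /\
    mup z (\prod_(k < n) ('X - (l k)%:P)) = (\sum_(k < n) (l k == z))%N.
apply: (big_rec2 (fun p m => p != 0 /\ mup z p = m)).
  by rewrite oner_eq0 mupNroot // root1.
move=> k m p _ [p0 <-]; have X0 : 'X - (l k)%:P != 0 by rewrite polyXsubC_eq0.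
by rewrite mulf_neq0 // mupM // -(expr1 ('X - _)) mup_XsubCX; case: eqP.
Qed.

(** * Arguments of two complex numbers with positive product *)

Section Arguments.
Variable R : realType.
Implicit Types z w : R[i].

(** Here [w] is a positive multiple of the conjugate of [z], so the [acos] term is shared and the
    imaginary parts have opposite signs. *)
Lemma arg_eq_opp z w : 0 < z * w ->
  [/\ z != 0, w != 0 & eq_mod_2pi (arg w) (- arg z)].
Proof.
move=> zw; have : z * w != 0 by rewrite gt_eqF.
rewrite mulf_eq0 negb_or => /andP[z0 w0]; split=> //.
have [t t0 wE] : exists2 t : R, 0 < t & w = t%:C * z^*%C.
  have zz : 0 < z * z^*%C by rewrite -sqr_normc exprn_gt0 // normr_gt0.
  have tE := RRe_real (gtr0_real (divr_gt0 zw zz)).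
  exists (complex.Re (z * w / (z * z^*%C))).
    by rewrite -ltcR tE divr_gt0.
  by rewrite tE; apply: (mulfI z0); rewrite mulrCA divfK // gt_eqF.
have t1 : t != 0 by rewrite gt_eqF.
have nw : normc w = t * normc z.
  have := complex_normE w; rewrite {1}wE normrM normcJ !complex_normE.
  rewrite /= expr0n /= addr0.
  by rewrite sqrtr_sqr gtr0_norm // -rmorphM => /complexI.
have Rew : complex.Re w = t * complex.Re z.
  by rewrite wE; case: (z) => a b /=; rewrite mul0r subr0.
have Imw : complex.Im w = - (t * complex.Im z).
  by rewrite wE; case: (z) => a b /=; rewrite mul0r addr0 mulrN.
rewrite /eq_mod_2pi /arg nw Rew Imw oppr_ge0 pmulr_rle0 //.
rewrite invfM mulrACA divff // mul1r.
set q := complex.Re z / normc z.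
case: (ltgtP (complex.Im z) 0) => Im0.
- by exists 0; rewrite mul0r addr0 opprK.
- by exists 0; rewrite mul0r addr0.
have nz : normc z = `|complex.Re z|.
  by case: (z) Im0 => a b /= ->; rewrite expr0n /= addr0 sqrtr_sqr.
have Re0 : complex.Re z != 0.
  by apply: contra_neq z0 => Re0; apply: eq0_normc; rewrite nz Re0 normr0.
have [qE|qE] : q = 1 \/ q = -1.
- rewrite /q nz; case: (ltgtP (complex.Re z) 0) Re0 => // Rez _.
    by right; rewrite ltr0_norm // invrN mulrN divff // lt_eqF.
  by left; rewrite gtr0_norm // divff // gt_eqF.
- by exists 0; rewrite qE acos1 oppr0 mul0r addr0.
(* On the negative real axis both principal arguments are [pi], so a full turn is needed. *)
by exists 1; rewrite qE acosN1 mul1r mulr2n addKr.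
Qed.

End Arguments.

(** * Consequences of primitive even compounds for the eigenvalues *)

Section PrimitiveCompounds.
Variables (R : realType) (n : nat) (A : 'M[R]_n) (l : 'I_n -> R[i]).
Hypothesis primitive_compounds : forall j : nat, (1 <= j <= n)%N -> ~~ odd j ->
  J_sign_symmetric_primitive (compound j A).
Hypothesis l_spectrum : eigenvalue_enumeration A l.

(** Indexing by naturals frees initial products from bound proofs; the default 0 keeps the moduli
    non-increasing past [n]. *)
Definition zero_extended (k : nat) : R[i] := oapp l 0 (insub k).
Local Notation L := zero_extended.

Lemma zero_extended_ord (k : 'I_n) : L k = l k.
Proof. by rewrite /zero_extended valK. Qed.

Lemma norm_zero_extended_noninc h k : (h <= k)%N -> `|L k| <= `|L h|.
Proof.
move=> hk; have [kn|nk] := ltnP k n.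
  have := l_spectrum.2 (Ordinal (leq_ltn_trans hk kn)) (Ordinal kn) hk.
  by rewrite -lecR -!zero_extended_ord.
by rewrite {1}/zero_extended insubF ?normr0 ?normr_ge0 // ltnNge nk.
Qed.

Definition initial_tuple j (jn : (j <= n)%N) : j.-tuple 'I_n :=
  mktuple (widen_ord jn).

(** The i-th entry of an increasing tuple is at least [i], so no product exceeds the initial one in
    modulus; the strictly dominant eigenvalue of the compound therefore sits at the initial
    tuple. *)
Lemma dominant_product j (jn : (j <= n)%N) : (0 < j)%N -> ~~ odd j ->
  0 < \prod_(i < j) L i /\
  forall t : j.-tuple 'I_n, sorted ltn (map val t) -> t != initial_tuple jn ->
    `|\prod_(i < j) L (tnth t i)| < `|\prod_(i < j) L i|.
Proof.
move=> j0 j_even; have jn1 : (1 <= j <= n)%N by rewrite j0.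
pose d r := \prod_(i < j) l (tnth (tnth (lex_increasing n j) r) i).
have dE : char_poly (complexify (compound j A)) =
    \prod_(r < 'C(n, j)) ('X - (d r)%:P).
  by rewrite /complexify map_compound (char_poly_compound j l_spectrum.1).
have Cgt0 : (0 < 'C(n, j))%N by rewrite bin_gt0.
have [r0 [d0 dom]] :=
  primitive_dominant Cgt0 (primitive_compounds jn1 j_even) dE.
have dL r : d r = \prod_(i < j) L (tnth (tnth (lex_increasing n j) r) i).
  by apply: eq_bigr => i _; rewrite zero_extended_ord.
have [ri riE] : exists r, tnth (lex_increasing n j) r = initial_tuple jn.
  by apply: lex_increasing_onto; apply: sorted_mktuple.
have diE : d ri = \prod_(i < j) L i.
  by rewrite dL riE; apply: eq_bigr => i _; rewrite tnth_mktuple.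
have r0i : r0 = ri.
  apply/eqP; apply: contraT; rewrite eq_sym => /dom.
  rewrite le_gtF // diE dL !normr_prod ler_prod // => i _.
  rewrite normr_ge0 norm_zero_extended_noninc //.
  exact: leq_ord_tnth_increasing (sorted_lex_increasing r0).
rewrite -diE -r0i; split=> // t /lex_increasing_onto[r <-] rt.
by rewrite -dL; apply: dom; apply: contraNneq rt => ->; rewrite r0i riE.
Qed.

Lemma modulus_gap k : odd k -> (k.+1 < n)%N -> `|L k.+1| < `|L k|.
Proof.
move=> k_odd kn.
have k1_even : ~~ odd k.+1 by rewrite /= negbK.
have [P0 dom] := dominant_product (ltnW kn) isT k1_even.
(* [bump k] skips the value [k], giving the competing tuple 0, ..., k-1, k+1; it shares its first
   [k] factors with the initial one, and they are nonzero because the initial product is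
   positive. *)
have bump_lt (i : 'I_k.+1) : (bump k i < n)%N.
  apply: (leq_ltn_trans _ kn).
  exact: (leq_add (leq_b1 _) (ltnSE (ltn_ord i))).
pose f i := Ordinal (bump_lt i).
have f_incr : {homo f : i h / (i < h)%N}.
  by move=> i h ih; rewrite /= ltnNge leq_bump2 -ltnNge.
have fE i : L (tnth (mktuple f) i) = L (bump k i) by rewrite tnth_mktuple.
have ft : mktuple f != initial_tuple (ltnW kn).
  apply/eqP => /(congr1 (fun t => val (tnth t ord_max))).
  by rewrite !tnth_mktuple /= /bump leqnn => /esym/n_Sn.
have := dom _ (sorted_mktuple f_incr) ft.
move: P0; rewrite (eq_bigr _ (fun i _ => fE i)) !big_ord_recr /=.
have -> : \prod_(i < k) L (bump k i) = \prod_(i < k) L i.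
  by apply: eq_bigr => i _; rewrite /bump leqNgt ltn_ord.
rewrite /bump leqnn add1n => P0; rewrite !normrM ltr_pM2l // normr_gt0.
by apply: contraTneq P0 => ->; rewrite mul0r ltxx.
Qed.

Lemma initial_product_gt0 j : (j <= n)%N -> ~~ odd j -> 0 < \prod_(i < j) L i.
Proof.
case: j => [|j] jn j_even; first by rewrite big_ord0 ltr01.
by have [] := dominant_product jn isT j_even.
Qed.

Lemma pair_product_gt0 k : ~~ odd k -> (k.+1 < n)%N -> 0 < L k * L k.+1.
Proof.
move=> k_even kn.
have := @initial_product_gt0 k.+2 kn; rewrite /= negbK => /(_ k_even).
rewrite !big_ord_recr /= -mulrA pmulr_rgt0 //.
by apply: initial_product_gt0; rewrite // ltnW // ltnW.
Qed.

(** The product of all eigenvalues is the real number [\det A], and the first [n - 1] of them, an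
    even number, have a positive product. *)
Lemma last_real (k : 'I_n) : odd n -> k.+1 = n -> complex.Im (l k) = 0.
Proof.
move=> n_odd kn; have [Q [T [Qu Tt QA Td]]] := triangularization l_spectrum.1.
have detA : (\det A)%:C = \prod_(i < n) L i.
  rewrite -det_map_mx -[map_mx _ A]/(complexify A).
  have -> : \det (complexify A) = \det T.
    have Q0 : \det Q != 0 by rewrite -unitfE -unitmxE.
    by apply: (mulfI Q0); rewrite -det_mulmx QA det_mulmx mulrC.
  by rewrite det_trig //; apply: eq_bigr => i _; rewrite zero_extended_ord Td.
have P0 : 0 < \prod_(i < k) L i.
  apply: initial_product_gt0; first exact: ltnW.
  by have /= -> := congr1 odd kn.
have : \prod_(i < n) L i = \prod_(i < k) L i * L k.
  by transitivity (\prod_(i < k.+1) L i); [rewrite kn | rewrite big_ord_recr].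
rewrite -detA zero_extended_ord -(RRe_real (gtr0_real P0)).
case: (l k) => a b [_ /eqP]; rewrite mul0r addr0 eq_sym mulf_eq0.
case/orP => [|/eqP //].
by move=> /eqP P00; move: P0; rewrite ltcE P00 ltxx andbF.
Qed.

Lemma spectral_radius_first (k : 'I_n) : k = 0%N :> nat ->
  spectral_radius A = normc (l k).
Proof.
move=> k0; have eigE z : eigenvalue (complexify A) z <-> exists h, l h = z.
  rewrite eigenvalue_root_char l_spectrum.1.
  split=> [|[h <-]]; last first.
    by rewrite (bigD1 h) //= rootM root_XsubC eqxx.
  move/rootP; rewrite horner_prod => /eqP/prodf_eq0[h _].
  by rewrite hornerXsubC subr_eq0 => /eqP zh; exists h.
rewrite /spectral_radius; set S := [set _ | _ in _]%classic.
have Sk : S (normc (l k)) by exists (l k) => //; apply/eigE; exists k.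
have ubS : ubound S (normc (l k)).
  move=> _ [z /eigE[h <-] <-]; apply: l_spectrum.2.
  by rewrite k0.
apply/le_anti/andP; split; first by apply: ge_sup => //; exists (normc (l k)).
by apply: ub_le_sup => //; exists (normc (l k)).
Qed.

(** If [m] is the least position of [z], any other is [m.+1]: of [m] and [m.+1] one is odd, and the
    modulus drops strictly right after it. *)
Lemma multiplicity_le2 z : (#|[set k | l k == z]| <= 2)%N.
Proof.
pose S := [set k | l k == z]%SET; rewrite -/S.
have [-> //|/card_gt0P[k1 Sk1]] := posnP #|S|.
pose m := arg_min k1 (mem S) val.
have [Sm min_m] : m \in S /\ forall k, k \in S -> (m <= k)%N.
  by rewrite /m; case: arg_minnP.
rewrite cardE -(size_map val) -[2%N]/(size [:: val m; m.+1]).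
apply: uniq_leq_size; first by rewrite (map_inj_uniq val_inj) enum_uniq.
move=> x /mapP[k]; rewrite mem_enum => Sk ->; rewrite !inE.
move: (min_m k Sk); rewrite leq_eqVlt => /predU1P[/val_inj ->|].
  by rewrite eqxx.
rewrite leq_eqVlt => /predU1P[->|mk]; first by rewrite eqxx orbT.
have normE : `|L m| = `|L k|.
  by move: Sm Sk; rewrite !zero_extended_ord !inE => /eqP -> /eqP ->.
have mkn := leq_ltn_trans mk (ltn_ord k).
have [m_odd|m_even] := boolP (odd m).
  have := modulus_gap m_odd (ltnW mkn).
  by rewrite normE le_gtF // norm_zero_extended_noninc // ltnW.
have := @modulus_gap m.+1 m_even mkn.
rewrite le_gtF //; apply: le_trans (norm_zero_extended_noninc (leqnSn m)) _.
by rewrite normE norm_zero_extended_noninc.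
Qed.

End PrimitiveCompounds.

Unset Implicit Arguments.

(* The k-th entry (k = 0, ..., n-1) of an enumeration l is lambda_(k+1): odd
   ordinals k are the even positions of the usual numbering from 1. *)
Theorem theorem7 (R : realType) (n : nat) (A : 'M[R]_n)
    (primitive_compounds : forall j : nat, (1 <= j <= n)%N -> ~~ odd j ->
       J_sign_symmetric_primitive (compound j A)) :
  (forall z : R[i], eigenvalue (complexify A) z -> (alg_mult A z <= 2)%N) /\
  (forall l : 'I_n -> R[i], eigenvalue_enumeration A l ->
     [/\ forall k : 'I_n, k = 0%N :> nat -> spectral_radius A = normc (l k),
         forall k k' : 'I_n, k' = k.+1 :> nat -> ~~ odd k ->
           normc (l k') <= normc (l k),
         forall k k' : 'I_n, k' = k.+1 :> nat -> odd k ->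
           normc (l k') < normc (l k),
         forall k k' : 'I_n, k' = k.+1 :> nat -> ~~ odd k ->
           [/\ l k != 0, l k' != 0 & eq_mod_2pi (arg (l k')) (- arg (l k))]
       & odd n -> forall k : 'I_n, k.+1 = n -> complex.Im (l k) = 0]).
Proof.
split=> [z _|l lA].
  have [l lA] := exists_sorted_spectrum (complexify A).
  rewrite /alg_mult lA.1 mup_prod_XsubC.
  exact: multiplicity_le2 primitive_compounds lA z.
split.
- exact: spectral_radius_first.
- by move=> k k' kk' _; apply: lA.2; rewrite kk'.
- move=> k k' kk' k_odd.
  have kn : (k.+1 < n)%N by rewrite -kk'.
  have := modulus_gap primitive_compounds lA k_odd kn.
  by rewrite -kk' !zero_extended_ord complex_normE complex_normE ltcR.
- move=> k k' kk' k_even; apply: arg_eq_opp.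
  have kn : (k.+1 < n)%N by rewrite -kk'.
  have := pair_product_gt0 primitive_compounds lA k_even kn.
  by rewrite -kk' !zero_extended_ord.
by move=> n_odd k; apply: (last_real primitive_compounds lA).
Qed.
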